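(* Let $X$ be a topological space, $Y$ a topological vector space, $\mathcal{B}$ a translation invariant cover of $Y$, $F:X\to 2^Y$ a multifunction which is $\mathcal{B}$-lsc at $x_0\in X$, and $g:X\to Y$ a function continuous at $x_0$. Then the vector sum $F+g$, defined by $(F+g)(x)=F(x)+g(x)=\{a+g(x):a\in F(x)\}$ for $x\in X$, is a multifunction which is $\mathcal{B}$-lsc at $x_0$.
   Context: $2^Y$ is the family of all subsets of $Y$ (including $\emptyset$); a multifunction from $X$ to $Y$ is a map $F:X\to 2^Y$. A cover of $Y$ is a family $\mathcal{B}$ of nonempty subsets of $Y$ with $\bigcup\mathcal{B}=Y$. It is translation invariant if $B+c\in\mathcal{B}$ for every $B\in\mathcal{B}$ and every $c\in Y$. $F$ is $\mathcal{B}$-lsc at $x_0$ (with respect to the natural uniformity of $Y$ generated by the neighbourhoods of $0$) if for every neighbourhood $V$ of $0$ in $Y$ and every $B\in\mathcal{B}$ there is a neighbourhood $U(x_0)$ of $x_0$ such that $F(x_0)\cap B\subset F(x)+V$ for every $x\in U(x_0)$, where $C+D=\{c+d:c\in C,\ d\in D\}$. *)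

(* Defs.v *)
From HB Require Import structures.
From mathcomp Require Import all_boot all_order all_algebra.
From mathcomp Require Import all_classical all_reals all_analysis.

Set Implicit Arguments.
Unset Strict Implicit.
Unset Printing Implicit Defensive.

Import Order.TTheory GRing.Theory Num.Theory.

Local Open Scope classical_set_scope.
Local Open Scope ring_scope.

Definition multifunction (X Y : Type) : Type := X -> set Y.

Definition is_cover (Y : Type) (BB : set (set Y)) : Prop :=
  (forall B, BB B -> B !=set0) /\ \bigcup_(B in BB) B = [set: Y].

Definition set_add (Y : zmodType) (C D : set Y) : set Y :=
  [set c + d | c in C & d in D].

Definition set_translate (Y : zmodType) (B : set Y) (c : Y) : set Y :=
  [set b + c | b in B].

Definition translation_invariant (Y : zmodType) (BB : set (set Y)) : Prop :=
  forall B c, BB B -> BB (set_translate B c).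

Definition lsc_wrt (K : numFieldType) (X : topologicalType)
    (Y : topologicalLmodType K) (BB : set (set Y)) (F : multifunction X Y)
    (x0 : X) : Prop :=
  forall V : set Y, nbhs 0 V -> forall B : set Y, BB B ->
    exists2 U : set X, nbhs x0 U &
      forall x, U x -> F x0 `&` B `<=` set_add (F x) V.

Definition vector_sum (X : Type) (Y : zmodType) (F : multifunction X Y)
    (g : X -> Y) : multifunction X Y :=
  fun x => set_translate (F x) (g x).

(* Main.v *)
(* If a + g x0 lies in B then a lies in the translate B - g x0, which is again
   a member of the cover; so a = b + w with b in F x and w small, whence
   a + g x0 = (b + g x) + (w + (g x0 - g x)). *)
Require Import Defs.
From HB Require Import structures.
From mathcomp Require Import all_boot all_order all_algebra.
From mathcomp Require Import all_classical all_reals all_analysis.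

Set Implicit Arguments.
Unset Strict Implicit.
Unset Printing Implicit Defensive.

Import Order.TTheory GRing.Theory Num.Theory.

Local Open Scope classical_set_scope.
Local Open Scope ring_scope.

Theorem theorem5p2 (K : numFieldType) (X : topologicalType)
    (Y : topologicalLmodType K) (BB : set (set Y)) (F : multifunction X Y)
    (g : X -> Y) (x0 : X)
    (BB_cover : is_cover BB) (BB_translation : translation_invariant BB)
    (F_lsc : lsc_wrt BB F x0) (g_cont : continuous_at x0 g) :
  lsc_wrt BB (vector_sum F g) x0.
Proof.
move=> V V0 B BBB.
have /= addY := @add_continuous Y (0, 0).
(* Splits [V] so that [W1 + W2] lies in [V]: [W1] is for the error from [F], [W2] for the variation
   of [g]. *)
have [[W1 W2] /= [W1_0 W2_0] W12V] :
    nbhs ((0, 0) : Y * Y) ((fun p : Y * Y => p.1 + p.2) @^-1` V).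
  by apply: addY; rewrite /= addr0.
have [U1 U1x0 F_U1] := F_lsc W1 W1_0 _ (BB_translation B (- g x0) BBB).
have dg : (fun x => g x0 - g x) @ x0 --> (0 : Y).
  (* Writing the limit [0] as [g x0 - g x0] reduces the claim to continuity of subtraction at
     [(g x0, g x0)]. *)
  rewrite -(subrr (g x0)).
  apply: (@continuous_comp _ _ _ (fun x => (g x0, g x))
    (fun p : Y * Y => p.1 - p.2)); last exact: sub_continuous.
  by apply: cvg_pair => /=; [exact: cvg_cst|exact: g_cont].
(* Neither factor depends on the point of [F x0], so one neighbourhood serves all of them. *)
exists (U1 `&` [set x | W2 (g x0 - g x)]); first exact: filterI U1x0 (dg _ W2_0).
move=> x [U1x W2x] _ [[a Fa <-] Bag].
have [|b Fb [w W1w bwE]] := F_U1 x U1x a.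
  by split=> //; exists (a + g x0) => //; rewrite addrK.
exists (b + g x); first by exists b.
exists (w + (g x0 - g x)); first exact: (W12V (_, _)).
by rewrite addrACA [g x + _]addrC subrK bwE.
Qed.
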